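(* For each integer $n\ge 1$, let $\Phi^{(n)}$ be a point cloud (a countable subset) in $\mathbb{R}^d$, and suppose that $$\epsilon_n:=\sup\{\delta_{\Phi^{(n)}}(q):q\in\mathbb{R}^d\}$$ is finite. Let $A$ be a compact subset of $\mathbb{R}^d$, and for $n\ge1$ define $\hat A^{(n)}:=A\cap\Phi^{(n)}$ and $$\hat{\mathrm r}_n:=\inf\left\{r>\epsilon_n:\ \left(\hat A^{(n)}_{r-\epsilon_n}\right)_{-(r+\epsilon_n)}\nsubseteq\hat A^{(n)}\right\},$$ where the subscripts denote the discrete dilation and erosion relative to the point cloud $\Phi^{(n)}$. Then $$\inf_{n\ge1}\hat{\mathrm r}_n\ \ge\ \operatorname{rconv}(A).$$ Moreover, if $\epsilon_n\to0$ and $d_H(\hat A^{(n)},A)\to0$ as $n\to\infty$, then $$\lim_{n\to\infty}\hat{\mathrm r}_n=\operatorname{rconv}(A).$$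
   Context: $\mathbb{R}^d$ carries the Euclidean norm $\|\cdot\|_2$, $\mathbb{R}^+=(0,\infty)$, and $B(s,r)$ is the closed ball of radius $r$ centred at $s$. For non-empty $S\subseteq\mathbb{R}^d$, $\delta_S(t):=\inf\{\|t-s\|_2:s\in S\}$ (with the convention $\delta_\emptyset\equiv+\infty$), and $\inf\emptyset=\infty$. Continuous operations: for $A\subseteq\mathbb{R}^d$, with $A\oplus B=\{x+y:x\in A,y\in B\}$ and $A\ominus B=(A^c\oplus B)^c$, let $A_r:=A\oplus B(0,r)$ for $r\ge0$ and $A_r:=A\ominus B(0,-r)$ for $r<0$; let $A_{\bullet r}:=(A_r)_{-r}$ for $r\in\mathbb{R}$. For closed $A$, $\operatorname{rconv}(A):=\sup\{r\in\mathbb{R}:A_{\bullet r}=A\}\in[0,\infty]$. Hausdorff distance: $d_H(A,B):=\inf\{r\in\mathbb{R}^+:A\subseteq B_r,\ B\subseteq A_r\}$ (continuous dilations). Discrete operations: for a point cloud $\Phi$ and a subset $\hat A\subseteq\Phi$, the notation $\hat A_r$ ($r\in\mathbb{R}$) denotes instead the subset of $\Phi$ given by $\hat A_r:=\{p\in\Phi:\delta_{\hat A}(p)\le r\}$ for $r\ge0$, and $\hat A_r:=\{a\in\hat A:\delta_{\Phi\setminus\hat A}(a)>-r\}$ for $r<0$. In the claim, $(\hat A^{(n)}_{r-\epsilon_n})_{-(r+\epsilon_n)}$ is obtained by applying first the discrete dilation by $r-\epsilon_n$ and then the discrete erosion by $r+\epsilon_n$, both with respect to $\Phi=\Phi^{(n)}$.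 *)

(* Defs.v *)
From HB Require Import structures.
From mathcomp Require Import all_boot all_order all_algebra.
From mathcomp Require Import all_classical all_reals all_analysis.

Set Implicit Arguments.
Unset Strict Implicit.
Unset Printing Implicit Defensive.

Import Order.TTheory GRing.Theory Num.Theory.
Import numFieldNormedType.Exports.

Local Open Scope classical_set_scope.
Local Open Scope ring_scope.

(* The library norm on 'rV[R]_d is the sup norm; it induces the same topology
   (hence the same compact sets) but not the same balls. *)
Definition enorm (R : realType) (d : nat) (x : 'rV[R]_d) : R :=
  Num.sqrt (\sum_(i < d) x ord0 i ^+ 2).

Definition eball (R : realType) (d : nat) (s : 'rV[R]_d) (r : R) :
  set 'rV[R]_d := [set x | enorm (x - s) <= r].

(* ereal_inf set0 = +oo, so setdist set0 t = +oo. *)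
Definition setdist (R : realType) (d : nat) (S : set 'rV[R]_d)
  (t : 'rV[R]_d) : \bar R := ereal_inf [set (enorm (t - s))%:E | s in S].

Definition mink_add (R : realType) (d : nat) (A B : set 'rV[R]_d) :
  set 'rV[R]_d := [set x + y | x in A & y in B].

Definition mink_sub (R : realType) (d : nat) (A B : set 'rV[R]_d) :
  set 'rV[R]_d := ~` mink_add (~` A) B.

(* A_r : dilation for 0 <= r, erosion for r < 0. *)
Definition offset (R : realType) (d : nat) (A : set 'rV[R]_d) (r : R) :
  set 'rV[R]_d :=
  if 0 <= r then mink_add A (eball 0 r) else mink_sub A (eball 0 (- r)).

(* A_{\bullet r} : closing for 0 <= r, opening for r < 0. *)
Definition bullet (R : realType) (d : nat) (A : set 'rV[R]_d) (r : R) :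
  set 'rV[R]_d := offset (offset A r) (- r).

Definition rconv (R : realType) (d : nat) (A : set 'rV[R]_d) : \bar R :=
  ereal_sup [set r%:E | r in [set r : R | bullet A r = A]].

Definition hausdorff (R : realType) (d : nat) (A B : set 'rV[R]_d) : \bar R :=
  ereal_inf [set r%:E | r in
    [set r : R | [/\ 0 < r, A `<=` offset B r & B `<=` offset A r]]].

(* Discrete counterpart of [offset], for subsets Ah of a point cloud Phi. *)
Definition doffset (R : realType) (d : nat) (Phi Ah : set 'rV[R]_d) (r : R) :
  set 'rV[R]_d :=
  if 0 <= r then [set p | Phi p /\ (setdist Ah p <= r%:E)%E]
  else [set a | Ah a /\ ((- r)%:E < setdist (Phi `\` Ah) a)%E].

Definition cover_radius (R : realType) (d : nat) (Phi : set 'rV[R]_d) :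
  \bar R := ereal_sup [set setdist Phi q | q in [set: 'rV[R]_d]].

(* Only meaningful when cover_radius Phi is finite (fine +oo = 0). *)
Definition rhat (R : realType) (d : nat) (Phi A : set 'rV[R]_d) : \bar R :=
  let eps := fine (cover_radius Phi) in
  let Ah := A `&` Phi in
  ereal_inf [set r%:E | r in [set r : R | eps < r /\
    ~ (doffset Phi (doffset Phi Ah (r - eps)) (- (r + eps)) `<=` Ah)]].

(* Main.v *)
Require Import Defs.
From HB Require Import structures.
From mathcomp Require Import all_boot all_order all_algebra.
From mathcomp Require Import all_classical all_reals all_analysis.
From mathcomp Require Import ring lra.
Set Implicit Arguments.
Unset Strict Implicit.
Unset Printing Implicit Defensive.

Import Order.TTheory GRing.Theory Num.Theory.
Import numFieldNormedType.Exports.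
Local Open Scope classical_set_scope.
Local Open Scope ring_scope.

(** For [r > 0], a point [x] lies in the closing [bullet A r] exactly when its
    closed ball of radius [r] is contained in the dilation of [A] by [r]
    ([bulletE]). Hence the closings of [A] grow with [r] ([ball_covered_le]),
    and for [r > 0] beyond [rconv A] some point off [A] has a ball covered in
    this way ([rconv_lt_witness]).

    Lower bound: the radii [r - eps] and [r + eps] are shifted so that a cloud
    point surviving the discrete dilation and erosion has its genuine ball of
    radius [r] covered ([doffset_ball_covered]); if [r < s] and [A] equals
    its closing by [s], that point is in [A] by monotonicity. So no radius below [rconv A]
    enters the infimum defining [rhat] ([rconv_le_rhat]).

    Upper bound: take [x] off [A] whose ball of radius [r] is covered, with
    [r] slightly larger than [rconv A]. The shift of the radii by [eps] goes the
    wrong way here, so some slack is needed, and strict convexity of the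
    Euclidean norm provides it: for [t > r] the ball of radius [t] around [x]
    lies within [t - k] of [A] for some [k > 0] independent of the cloud
    ([ball_covered_gap]). Once [eps] and the Hausdorff distance are small
    compared with [k] and with the distance from [x] to [A], a cloud point
    next to [x] shows that [rhat] is at most [t] ([rhat_le]). *)

(** * The Euclidean norm *)

Lemma enorm_ge0 (R : realType) (d : nat) (x : 'rV[R]_d) : 0 <= enorm x.
Proof. exact: sqrtr_ge0. Qed.

Lemma enorm_sqr (R : realType) (d : nat) (x : 'rV[R]_d) :
  enorm x ^+ 2 = \sum_(i < d) x ord0 i ^+ 2.
Proof. by rewrite sqr_sqrtr// sumr_ge0// => i _; exact: sqr_ge0. Qed.

Lemma enorm0 (R : realType) (d : nat) : enorm (0 : 'rV[R]_d) = 0.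
Proof. by rewrite /enorm big1 ?sqrtr0// => i _; rewrite mxE expr0n. Qed.

Lemma enorm_eq0 (R : realType) (d : nat) (x : 'rV[R]_d) : enorm x = 0 -> x = 0.
Proof.
move=> x0; have /eqP := enorm_sqr x.
rewrite x0 expr0n/= eq_sym psumr_eq0; last by move=> i _; exact: sqr_ge0.
move=> /allP xi0; apply/rowP => i; rewrite mxE.
by have := xi0 i; rewrite mem_index_enum sqrf_eq0 => /(_ isT)/eqP.
Qed.

Lemma enormB (R : realType) (d : nat) (x y : 'rV[R]_d) :
  enorm (x - y) = enorm (y - x).
Proof.
by rewrite /enorm; congr Num.sqrt; apply: eq_bigr => i _; rewrite !mxE; ring.
Qed.

Lemma enormZ (R : realType) (d : nat) (a : R) (x : 'rV[R]_d) :
  0 <= a -> enorm (a *: x) = a * enorm x.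
Proof.
move=> a0; rewrite /enorm; under eq_bigr do rewrite mxE exprMn.
by rewrite -mulr_sumr sqrtrM ?sqr_ge0// sqrtr_sqr ger0_norm.
Qed.

(** Expanding the nonnegative square of [b *: x - a *: y] with [a = enorm x]
    and [b = enorm y] bounds the inner product by [a * b], up to a factor
    [2 * a * b] that can be cancelled unless one of the vectors is zero. *)
Lemma cauchy_schwarz (R : realType) (d : nat) (x y : 'rV[R]_d) :
  \sum_(i < d) x ord0 i * y ord0 i <= enorm x * enorm y.
Proof.
have [x0|x_neq0] := eqVneq (enorm x) 0.
  rewrite x0 mul0r big1// => i _.
  by rewrite (enorm_eq0 x0) mxE mul0r.
have [y0|y_neq0] := eqVneq (enorm y) 0.
  rewrite y0 mulr0 big1// => i _.
  by rewrite (enorm_eq0 y0) mxE mulr0.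
set s := \sum_(i < d) _.
have: 0 <= \sum_(i < d) (enorm y * x ord0 i - enorm x * y ord0 i) ^+ 2.
  by rewrite sumr_ge0// => i _; exact: sqr_ge0.
have -> : \sum_(i < d) (enorm y * x ord0 i - enorm x * y ord0 i) ^+ 2
    = enorm y ^+ 2 * \sum_(i < d) x ord0 i ^+ 2
      + enorm x ^+ 2 * \sum_(i < d) y ord0 i ^+ 2
      - (2 * enorm x * enorm y) * s.
  rewrite !mulr_sumr -big_split -sumrB/=; apply: eq_bigr => i _; ring.
rewrite -!enorm_sqr => sq_ge0.
have ab_gt0 : 0 < enorm x * enorm y.
  by rewrite mulr_gt0// lt_neqAle eq_sym ?x_neq0 ?y_neq0 enorm_ge0.
rewrite -(ler_pM2l ab_gt0); lra.
Qed.

Lemma ler_enormD (R : realType) (d : nat) (x y : 'rV[R]_d) :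
  enorm (x + y) <= enorm x + enorm y.
Proof.
rewrite -(@ler_pXn2r _ 2)// ?nnegrE ?addr_ge0 ?enorm_ge0//.
rewrite sqrrD !enorm_sqr.
have -> : \sum_(i < d) (x + y) ord0 i ^+ 2 = \sum_(i < d) x ord0 i ^+ 2
    + 2 * (\sum_(i < d) x ord0 i * y ord0 i) + \sum_(i < d) y ord0 i ^+ 2.
  by rewrite mulr_sumr -!big_split/=; apply: eq_bigr => i _; rewrite mxE; ring.
have := cauchy_schwarz x y; lra.
Qed.

Lemma ler_enorm_distD (R : realType) (d : nat) (y x z : 'rV[R]_d) :
  enorm (x - z) <= enorm (x - y) + enorm (y - z).
Proof.
by rewrite (le_trans _ (ler_enormD _ _))// addrA subrK.
Qed.

(** This is Stewart's theorem for the cevian from [a] to the point dividing the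
    segment from [x] to [q] in the ratio [l : 1 - l]. *)
Lemma stewart (R : realType) (d : nat) (l : R) (x q a : 'rV[R]_d) :
  enorm (x + l *: (q - x) - a) ^+ 2 =
  (1 - l) * enorm (x - a) ^+ 2 + l * enorm (q - a) ^+ 2
  - l * (1 - l) * enorm (q - x) ^+ 2.
Proof.
rewrite !enorm_sqr !mulr_sumr -big_split -sumrB/=.
by apply: eq_bigr => i _; rewrite !mxE; ring.
Qed.

Lemma continuous_enorm_dist (R : realType) (d : nat) (x : 'rV[R]_d) :
  continuous (fun a : 'rV[R]_d => enorm (x - a)).
Proof.
move=> a.
suff c : \sum_(i < d) (x - b) ord0 i ^+ 2 @[b --> a]
    --> \sum_(i < d) (x - a) ord0 i ^+ 2.
  exact: (cvg_comp _ _ c (@sqrt_continuous _ _)).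
apply: (cvg_big add_continuous (nbhs_filter a)) => i _.
under eq_fun do rewrite !mxE expr2.
rewrite !mxE expr2.
have c : x ord0 i - b ord0 i @[b --> a] --> x ord0 i - a ord0 i.
  apply: (@cvgB _ _ _ (nbhs a) (nbhs_filter a)); first exact: cst_continuous.
  exact: coord_continuous.
exact: (@cvgM _ _ (nbhs a) (nbhs_filter a)).
Qed.

Lemma compact_nearest (R : realType) (d : nat) (A : set 'rV[R]_d)
    (x : 'rV[R]_d) : compact A -> A !=set0 ->
  exists2 a, A a & forall b, A b -> enorm (x - a) <= enorm (x - b).
Proof.
move=> cA A0.
have [|a] := compact_EVT_min (f := fun a : 'rV[R]_d => enorm (x - a)) A0 cA.
  by apply: continuous_subspaceT; exact: continuous_enorm_dist.
rewrite inE => Aa amin; exists a => // b Ab.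
by apply: amin; rewrite inE.
Qed.

(** * Dilations and closings in terms of balls *)

Lemma offsetE (R : realType) (d : nat) (A : set 'rV[R]_d) (r : R)
    (x : 'rV[R]_d) : 0 <= r ->
  offset A r x <-> exists2 a, A a & enorm (x - a) <= r.
Proof.
move=> r0; rewrite /offset r0; split.
  move=> [a Aa [y]]; rewrite /eball/= subr0 => yr <-.
  by exists a => //; rewrite addrAC subrr add0r.
move=> [a Aa xar]; exists a => //; exists (x - a); last by rewrite addrC subrK.
by rewrite /eball/= subr0.
Qed.

Definition ball_covered (R : realType) (d : nat) (A : set 'rV[R]_d) (r : R)
    (x : 'rV[R]_d) :=
  forall q, enorm (q - x) <= r -> exists2 a, A a & enorm (q - a) <= r.

Lemma bulletE (R : realType) (d : nat) (A : set 'rV[R]_d) (r : R)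
    (x : 'rV[R]_d) : 0 < r -> bullet A r x <-> ball_covered A r x.
Proof.
move=> r0; have rN : (0 <= - r) = false by apply/negbTE; rewrite -ltNge; lra.
rewrite /bullet {1}/offset rN opprK; split.
  move=> xA q qx; apply/offsetE; first exact: ltW.
  apply: contrapT => nq; apply: xA; exists q => //; exists (x - q).
    by rewrite /eball/= subr0 enormB.
  by rewrite addrC subrK.
move=> xA [q nq [y]]; rewrite /eball/= subr0 => yr qyx; apply: nq.
apply/offsetE; first exact: ltW.
by apply: xA; rewrite enormB -qyx addrAC subrr add0r.
Qed.

Lemma bullet0 (R : realType) (d : nat) (A : set 'rV[R]_d) : bullet A 0 = A.
Proof.
have offset0 (B : set 'rV[R]_d) : offset B 0 = B.
  apply/seteqP; split => x; last first.
    by move=> Bx; apply/offsetE => //; exists x; rewrite // subrr enorm0.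
  move=> /offsetE-/(_ (lexx _))[b Bb xb].
  have /enorm_eq0/eqP : enorm (x - b) = 0.
    by apply/eqP; rewrite eq_le xb enorm_ge0.
  by rewrite subr_eq0 => /eqP ->.
by rewrite /bullet oppr0 !offset0.
Qed.

Lemma sub_bullet (R : realType) (d : nat) (A : set 'rV[R]_d) (r : R) :
  0 < r -> A `<=` bullet A r.
Proof. by move=> r0 x Ax; apply/bulletE => // q qx; exists x. Qed.

Lemma rconv_ge0 (R : realType) (d : nat) (A : set 'rV[R]_d) :
  (0 <= rconv A)%E.
Proof. by apply: ereal_sup_ubound; exists 0 => //; exact: bullet0. Qed.

(** A point of the larger ball is pulled back to the smaller ball along the
    segment to the centre, which costs at most the extra radius [s - r]. *)
Lemma ball_covered_le (R : realType) (d : nat) (A : set 'rV[R]_d) (r s : R)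
    (x : 'rV[R]_d) : 0 <= r <= s -> 0 < s ->
  ball_covered A r x -> ball_covered A s x.
Proof.
move=> /andP[r0 rs] s0 xr q qx.
have l0 : 0 <= r / s by rewrite divr_ge0// ltW.
have l1 : r / s <= 1 by rewrite ler_pdivrMr// mul1r.
have rE : r / s * s = r by rewrite divfK// gt_eqF.
have [|a Aa ya] := xr (x + (r / s) *: (q - x)).
  rewrite addrAC subrr add0r enormZ//.
  by rewrite -[leRHS]rE ler_wpM2l.
exists a => //; apply: le_trans (ler_enorm_distD (x + (r / s) *: (q - x)) _ _) _.
have -> : q - (x + (r / s) *: (q - x)) = (1 - r / s) *: (q - x).
  by rewrite scalerBl scale1r opprD addrA.
rewrite enormZ ?subr_ge0//.
have : (1 - r / s) * enorm (q - x) <= (1 - r / s) * s.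
  by rewrite ler_wpM2l// subr_ge0.
lra.
Qed.

(** * Distances to sets and point clouds *)

Lemma setdist_le (R : realType) (d : nat) (S : set 'rV[R]_d) (t s : 'rV[R]_d) :
  S s -> (setdist S t <= (enorm (t - s))%:E)%E.
Proof. by move=> Ss; apply: ereal_inf_lbound; exists s. Qed.

Lemma setdist_lt (R : realType) (d : nat) (S : set 'rV[R]_d) (t : 'rV[R]_d)
    (e : R) : (setdist S t < e%:E)%E -> exists2 s, S s & enorm (t - s) < e.
Proof.
by move=> /ereal_inf_lt[_ [s Ss <-]]; rewrite lte_fin => ?; exists s.
Qed.

Lemma setdist_ge0 (R : realType) (d : nat) (S : set 'rV[R]_d) (t : 'rV[R]_d) :
  (0 <= setdist S t)%E.
Proof. by apply: le_ereal_inf_tmp => _ [s _ <-]; rewrite lee_fin enorm_ge0. Qed.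

Lemma fine_cover_radius_ge0 (R : realType) (d : nat) (Phi : set 'rV[R]_d) :
  0 <= fine (cover_radius Phi).
Proof.
apply: fine_ge0; apply: le_trans (setdist_ge0 Phi 0) _.
by apply: ereal_sup_ubound; exists 0.
Qed.

Lemma cover_radius_near (R : realType) (d : nat) (Phi : set 'rV[R]_d)
    (q : 'rV[R]_d) (e : R) : cover_radius Phi \is a fin_num -> 0 < e ->
  exists2 p, Phi p & enorm (q - p) < fine (cover_radius Phi) + e.
Proof.
move=> fin e0; apply: setdist_lt.
apply: (@le_lt_trans _ _ (cover_radius Phi)).
  by apply: ereal_sup_ubound; exists q.
by rewrite -{1}(fineK fin) lte_fin; lra.
Qed.

(** * The lower bound *)

Lemma compact_within (R : realType) (d : nat) (A : set 'rV[R]_d)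
    (q : 'rV[R]_d) (r : R) : compact A ->
  (forall e, 0 < e -> exists2 a, A a & enorm (q - a) < r + e) ->
  exists2 a, A a & enorm (q - a) <= r.
Proof.
move=> cA near.
have A0 : A !=set0 by have [a Aa _] := near _ ltr01; exists a.
have [a Aa amin] := compact_nearest q cA A0.
exists a => //; apply/ler_addgt0Pr => e e0.
by have [b Ab qb] := near _ e0; apply: le_trans (amin _ Ab) (ltW qb).
Qed.

(** The point cloud is [eps]-dense, so a point [x] that survives dilation by
    [r - eps] followed by erosion by [r + eps] has its whole ball of radius
    [r] covered: a point [q] of that ball has a cloud point [p] within about
    [eps], whose distance to [x] is then less than the inner margin left by
    the erosion, so that [p] lies in the dilation, within [r - eps] of [A]. *)
Lemma doffset_ball_covered (R : realType) (d : nat) (Phi A : set 'rV[R]_d)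
    (r : R) (x : 'rV[R]_d) :
  compact A -> cover_radius Phi \is a fin_num ->
  let eps := fine (cover_radius Phi) in eps < r ->
  doffset Phi (doffset Phi (A `&` Phi) (r - eps)) (- (r + eps)) x ->
  ball_covered A r x.
Proof.
move=> cA fin eps er; have eps0 : 0 <= eps := fine_cover_radius_ge0 Phi.
have rN : (0 <= - (r + eps)) = false by apply/negbTE; rewrite -ltNge; lra.
rewrite {1}/doffset rN opprK; set D := doffset _ _ _ => -[_ xD].
(* The erosion inequality is strict; [m] is the slack it leaves. *)
have [m m0 xm] : exists2 m, 0 < m &
    forall p, Phi p -> enorm (x - p) < r + eps + m -> D p.
  suff [m m0 xm] : exists2 m, 0 < m & ((r + eps + m)%:E <= setdist (Phi `\` D) x)%E.
    exists m => // p Pp xp; apply: contrapT => nDp.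
    have /(le_trans xm) := @setdist_le _ _ (Phi `\` D) x p (conj Pp nDp).
    by rewrite lee_fin leNgt xp.
  case: (setdist _ _) xD => [t||] // xD; last by exists 1; rewrite ?leey.
  exists (t - (r + eps)); first by rewrite subr_gt0 -lte_fin.
  by rewrite lee_fin; lra.
move=> q qx; apply: compact_within => // e e0.
have em0 : 0 < Num.min e m by rewrite lt_min e0.
have [p Pp qp] := cover_radius_near q fin em0.
have eme : Num.min e m <= e by rewrite ge_min lexx.
have emm : Num.min e m <= m by rewrite ge_min lexx orbT.
have Dp : D p.
  apply: xm => //; have := ler_enorm_distD q x p.
  by rewrite (enormB x q) -/eps; move: qp qx; rewrite -/eps; lra.
have re0 : 0 <= r - eps by lra.
move: Dp; rewrite /D /doffset re0 => -[_ pA].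
(* The gap left by the strict inequality [qp] makes up for the infimum
   defining the distance to the sample possibly not being attained. *)
have g0 : 0 < (eps + e - enorm (q - p)) by move: qp; rewrite -/eps; lra.
have [|a [Aa _] pa] := @setdist_lt _ _ (A `&` Phi) p
    (r - eps + (eps + e - enorm (q - p))).
  by apply: le_lt_trans pA _; rewrite lte_fin; lra.
exists a => //; have := ler_enorm_distD p q a; lra.
Qed.

Lemma rconv_le_rhat (R : realType) (d : nat) (Phi A : set 'rV[R]_d) :
  compact A -> cover_radius Phi \is a fin_num -> (rconv A <= rhat Phi A)%E.
Proof.
move=> cA fin; apply: ge_ereal_sup => _ [s sA <-].
apply: le_ereal_inf_tmp => _ [r [er nsub] <-].
rewrite lee_fin leNgt; apply/negP => rs; apply: nsub => x xD.
have eps0 := fine_cover_radius_ge0 Phi.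
have s0 : 0 < s by lra.
have Ax : A x.
  rewrite -sA; apply/bulletE => //.
  apply: ball_covered_le (doffset_ball_covered cA fin er xD) => //.
  by rewrite (ltW rs) andbT; lra.
split=> //.
have rN : (0 <= - (r + fine (cover_radius Phi))) = false.
  by apply/negbTE; rewrite -ltNge; lra.
have re0 : 0 <= r - fine (cover_radius Phi) by lra.
by move: xD; rewrite {1}/doffset rN /doffset re0 => -[[]].
Qed.

(** * The upper bound *)

(** Write a point [q] of the larger ball as the end of a segment starting at
    [x] and passing through a point [y] of the ball of radius [r]. By
    assumption [y] is within [r] of some [a] in [A]. For [q] at distance [t]
    from [x], equality [enorm (q - a) = t] would force [a] to be the centre
    [x], which stays at distance at least [c] from [A]; Stewart's identity
    turns this into the uniform bound [t ^+ 2 - c ^+ 2 * (t - r) / r] on the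
    squared distance. *)
Lemma ball_covered_gap (R : realType) (d : nat) (A : set 'rV[R]_d) (r t c : R)
    (x : 'rV[R]_d) : 0 < r < t -> 0 < c ->
  (forall a, A a -> c <= enorm (x - a)) -> ball_covered A r x ->
  exists2 k, 0 < k < t &
    forall q, enorm (q - x) <= t -> exists2 a, A a & enorm (q - a) <= t - k.
Proof.
move=> /andP[r0 rt] c0 xA xr; have t0 : 0 < t by lra.
set m := c ^+ 2 * (t - r) / r.
have m0 : 0 < m by rewrite divr_gt0// mulr_gt0 ?exprn_gt0// subr_gt0.
(* The first bound on [k] gives [t ^+ 2 - m <= (t - k) ^+ 2]. *)
pose k := Num.min (m / (2 * t)) (t / 2).
have k0 : 0 < k.
  by rewrite lt_min; apply/andP; split; rewrite divr_gt0// mulr_gt0.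
have kt : k <= t / 2 by rewrite ge_min lexx orbT.
have km : 2 * t * k <= m.
  have : k <= m / (2 * t) by rewrite ge_min lexx.
  by rewrite ler_pdivlMr ?mulr_gt0// mulrC.
exists k; first by rewrite k0; lra.
move=> q qx; pose l := r / t.
have l0 : 0 < l by rewrite divr_gt0.
have l1 : l < 1 by rewrite ltr_pdivrMr// mul1r.
have ltE : l * t = r by rewrite divfK// gt_eqF.
have [|a Aa ya] := xr (x + l *: (q - x)).
  by rewrite addrAC subrr add0r enormZ ?(ltW l0)// -ltE ler_wpM2l// ltW.
exists a => //.
have ya2 : enorm (x + l *: (q - x) - a) ^+ 2 <= r ^+ 2.
  by rewrite lerXn2r// ?nnegrE ?enorm_ge0// ltW.
have xa2 : (1 - l) * c ^+ 2 <= (1 - l) * enorm (x - a) ^+ 2.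
  rewrite ler_wpM2l ?subr_ge0 ?(ltW l1)// lerXn2r// ?nnegrE ?enorm_ge0 ?(ltW c0)//.
  exact: xA.
have qx2 : l * (1 - l) * enorm (q - x) ^+ 2 <= l * (1 - l) * t ^+ 2.
  have ll0 : 0 <= l * (1 - l) by apply: mulr_ge0; lra.
  by rewrite ler_wpM2l// lerXn2r// ?nnegrE ?enorm_ge0// ltW.
have mE : l * m = (1 - l) * c ^+ 2.
  by rewrite /l /m; field; rewrite !gt_eqF.
have rE : r ^+ 2 = l * t ^+ 2 - l * (1 - l) * t ^+ 2 by rewrite -ltE; ring.
have qa2 : enorm (q - a) ^+ 2 <= t ^+ 2 - m.
  rewrite -(ler_pM2l l0); move: ya2; rewrite stewart; lra.
rewrite -(@ler_pXn2r _ 2)// ?nnegrE ?enorm_ge0//; last by lra.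
apply: le_trans qa2 _; have := sqr_ge0 k; rewrite sqrrB; lra.
Qed.

(** By [ball_covered_gap] the ball of radius [t] around [x] lies within
    [t - k] of [A], so radius [t - k / 2] in the definition of [rhat] has room
    [k / 2] on both sides. This absorbs the errors made by replacing [x] by a
    cloud point [p] and [A] by its sample, all of them of order [eps] or of
    the Hausdorff distance; [p] then survives but stays off [A]. *)
Lemma rhat_le (R : realType) (d : nat) (A : set 'rV[R]_d) (r t : R)
    (x : 'rV[R]_d) : compact A -> 0 < r < t -> ~ A x -> ball_covered A r x ->
  exists2 h, 0 < h & forall Phi : set 'rV[R]_d,
    cover_radius Phi \is a fin_num -> fine (cover_radius Phi) < h ->
    (hausdorff (A `&` Phi) A < h%:E)%E -> (rhat Phi A <= t%:E)%E.
Proof.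
move=> cA rt nAx xr.
have A0 : A !=set0.
  have [|a Aa _] := xr x; last by exists a.
  by rewrite subrr enorm0; case/andP: rt => /ltW.
have [a Aa amin] := compact_nearest x cA A0.
have c0 : 0 < enorm (x - a).
  rewrite lt_neqAle enorm_ge0 andbT; apply/eqP => /esym/enorm_eq0/eqP.
  by rewrite subr_eq0 => /eqP xa; apply: nAx; rewrite xa.
set c := enorm (x - a) in c0 amin.
have [k /andP[k0 kt] gap] := ball_covered_gap rt c0 amin xr.
pose h := Num.min (k / 8) (c / 2).
have h0 : 0 < h by rewrite lt_min !divr_gt0.
have hk : h <= k / 8 by rewrite ge_min lexx.
have hc : h <= c / 2 by rewrite ge_min lexx orbT.
exists h => // Phi fin; set eps := fine _ => eh.
have eps0 : 0 <= eps := fine_cover_radius_ge0 Phi.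
move=> /ereal_inf_lt[_ [e [e0 _ AsubPhi] <-]]; rewrite lte_fin => eh'.
have [p Pp xp] := cover_radius_near x fin h0; rewrite -/eps in xp.
have nAp : ~ A p by move=> /amin; lra.
pose s := t - k / 2.
apply: (@le_trans _ _ s%:E); last by rewrite lee_fin /s; lra.
apply: ereal_inf_lbound; exists s => //; rewrite -/eps.
split; first by rewrite /s; lra.
have sN : (0 <= - (s + eps)) = false.
  by apply/negbTE; rewrite -ltNge /s; lra.
have se0 : 0 <= s - eps by rewrite /s; lra.
have pD q : Phi q -> enorm (p - q) < s + eps + h ->
    doffset Phi (A `&` Phi) (s - eps) q.
  move=> Pq pq; rewrite /doffset se0; split=> //.
  have [|b Ab qb] := gap q.
    have := ler_enorm_distD p q x; rewrite (enormB q p) (enormB p x).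
    by move: pq; rewrite /s; lra.
  have /offsetE-/(_ (ltW e0))[b' bb' b'b] := AsubPhi _ Ab.
  apply: le_trans (setdist_le q bb') _; rewrite lee_fin.
  have := ler_enorm_distD b q b'; rewrite /s; lra.
move=> /(_ p)[|//].
rewrite {1}/doffset sN opprK; split.
  by apply: pD => //; rewrite subrr enorm0 /s; lra.
apply: (@lt_le_trans _ _ (s + eps + h)%:E); first by rewrite lte_fin; lra.
apply: le_ereal_inf_tmp => _ [q [Pq nDq] <-].
by rewrite lee_fin leNgt; apply/negP => /(pD q Pq).
Qed.

Lemma rconv_lt_witness (R : realType) (d : nat) (A : set 'rV[R]_d) (r : R) :
  (rconv A < r%:E)%E -> exists2 x, ~ A x & ball_covered A r x.
Proof.
move=> Ar; have r0 : 0 < r by rewrite -lte_fin (le_lt_trans (rconv_ge0 A)).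
apply: contrapT => nx; move: Ar; rewrite ltNge => /negP; apply.
apply: ereal_sup_ubound; exists r => //.
apply/seteqP; split => [x /bulletE-/(_ r0) xr|]; last exact: sub_bullet.
by apply: contrapT => nAx; apply: nx; exists x.
Qed.

Lemma cvge0_near_fin_lt (R : realType) (u : nat -> \bar R) (h : R) :
  u n @[n --> \oo] --> (0%:E : \bar R) -> 0 < h ->
  \forall n \near \oo, u n \is a fin_num /\ fine (u n) < h.
Proof.
move=> /fine_cvgP[ufin /cvgrPdist_lt u0] h0.
near=> n; split; first by near: n.
apply: le_lt_trans (ler_norm _) _; rewrite -normrN -sub0r.
by near: n; exact: u0.
Unshelve. all: by end_near. Qed.

(** * Convergence *)

Theorem theorem3 (R : realType) (d : nat)
  (Phi : nat -> set 'rV[R]_d) (A : set 'rV[R]_d)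
  (Phi_countable : forall n, (1 <= n)%N -> countable (Phi n))
  (eps_fin : forall n, (1 <= n)%N -> cover_radius (Phi n) \is a fin_num)
  (A_compact : compact A) :
  (rconv A <=
     ereal_inf [set rhat (Phi n) A | n in [set n : nat | (1 <= n)%N]])%E
  /\
  ((cover_radius (Phi n) @[n --> \oo] --> (0%:E : \bar R)) ->
   (hausdorff (A `&` Phi n) A @[n --> \oo] --> (0%:E : \bar R)) ->
   rhat (Phi n) A @[n --> \oo] --> rconv A).
Proof.
have lower n : (1 <= n)%N -> (rconv A <= rhat (Phi n) A)%E.
  by move=> n1; apply: rconv_le_rhat => //; exact: eps_fin.
split; first by apply: le_ereal_inf_tmp => _ [n n1 <-]; exact: lower.
move=> eps_cvg haus_cvg.
have [rconv_fin|] := boolP (rconv A \is a fin_num); last first.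
  rewrite ge0_fin_numE ?rconv_ge0// -leNgt leye_eq => /eqP rconvE.
  apply: cvg_near_cst; near=> n.
  apply/eqP; rewrite rconvE -leye_eq -rconvE; apply: lower.
  by near: n; exact: nbhs_infty_ge.
pose rho := fine (rconv A).
have rhoE : rconv A = rho%:E by rewrite fineK.
have rho0 : 0 <= rho by rewrite fine_ge0// rconv_ge0.
have upper e : 0 < e ->
    \forall n \near \oo, (rho%:E <= rhat (Phi n) A <= (rho + e)%:E)%E.
  move=> e0.
  have [|x nAx xr] := @rconv_lt_witness _ _ A (rho + e / 2).
    by rewrite rhoE lte_fin; lra.
  have rt : 0 < rho + e / 2 < rho + e by apply/andP; split; lra.
  have [h h0 rhat_h] := rhat_le A_compact rt nAx xr.
  have eps_h := cvge0_near_fin_lt eps_cvg h0.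
  have haus_h := cvge0_near_fin_lt haus_cvg h0.
  near=> n; apply/andP; split.
    by rewrite -rhoE; apply: lower; near: n; exact: nbhs_infty_ge.
  have [ef eh] : cover_radius (Phi n) \is a fin_num /\
    fine (cover_radius (Phi n)) < h by near: n.
  have [hf hh] : hausdorff (A `&` Phi n) A \is a fin_num /\
    fine (hausdorff (A `&` Phi n) A) < h by near: n.
  by apply: rhat_h => //; rewrite -(fineK hf) lte_fin.
have bracket e n : (rho%:E <= rhat (Phi n) A <= (rho + e)%:E)%E ->
    rhat (Phi n) A \is a fin_num /\ rho <= fine (rhat (Phi n) A) <= rho + e.
  by case: (rhat _ _) => [s||]; rewrite ?leeNy_eq ?leye_eq ?andbF.
rewrite rhoE; apply/fine_cvgP; split.
  by apply: filterS (upper 1 ltr01) => n /bracket[].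
apply/cvgrPdist_le => e e0.
apply: filterS (upper e e0) => n /bracket[_ /andP[lo up]].
by rewrite /= distrC ger0_norm ?subr_ge0// lerBlDl.
Unshelve. all: by end_near. Qed.
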